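(* Let $X$ be a topological space, let $A$ be a set, let $B\subseteq\mathcal P(A)$, and put $I=B$ and $$E=\{Z\subseteq B\mid \text{for every }a\in A\text{ there is }H\in Z\text{ such that }a\in H\}=\{Z\subseteq B\mid \textstyle\bigcup Z=A\}.$$ Then the following conditions are equivalent. (1) $X$ is $[B,A]$-compact. (2) $X$ satisfies the $E$-accumulation property.
   Context: $\mathcal P(A)$ is the set of all subsets of $A$; no separation axiom is assumed. For a set $A$ and $B\subseteq\mathcal P(A)$, $X$ is $[B,A]$-compact if, whenever $(O_a)_{a\in A}$ is a sequence (indexed family) of open sets of $X$ with $\bigcup_{a\in A}O_a=X$, there is $H\in B$ such that $\bigcup_{a\in H}O_a=X$. For a set $I$, $E\subseteq\mathcal P(I)$ and an $I$-indexed sequence $(x_i)_{i\in I}$ of elements of $X$, a point $x\in X$ is an $E$-accumulation point of the sequence if $\{i\in I\mid x_i\in U\}\in E$ for every open neighborhood $U$ of $x$. $X$ satisfies the $E$-accumulation property if every $I$-indexed sequence of elements of $X$ has some (not necessarily unique) $E$-accumulation point. *)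

(* Defs.v *)
From mathcomp Require Import all_boot.
From mathcomp Require Import boolp classical_sets filter topology.

Set Implicit Arguments.
Unset Strict Implicit.
Unset Printing Implicit Defensive.

Local Open Scope classical_set_scope.

Definition BA_compact (X : topologicalType) (A : Type) (B : set (set A)) : Prop :=
  forall O : A -> set X,
    (forall a, open (O a)) ->
    \bigcup_a O a = [set: X] ->
    exists2 H : set A, B H & \bigcup_(a in H) O a = [set: X].

Definition accumulation_point (X : topologicalType) (I : Type)
    (E : set (set I)) (x : I -> X) (p : X) : Prop :=
  forall U : set X, open_nbhs p U -> E [set i | U (x i)].

Definition accumulation_property (X : topologicalType) (I : Type)
    (E : set (set I)) : Prop :=
  forall x : I -> X, exists p : X, accumulation_point E x p.

(* Subsets of B are taken as sets over the subtype [set_type B] of [set A],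
   which is the index type I = B; [val] is its inclusion into [set A]. *)
Definition covering_subfamilies (A : Type) (B : set (set A)) :
    set (set (set_type B)) :=
  [set Z | forall a : A, exists2 H : set_type B, Z H & (val H) a].

Arguments covering_subfamilies {A} B _.

Lemma covering_subfamiliesE (A : Type) (B : set (set A)) :
  covering_subfamilies B =
  [set Z | \bigcup_(H in Z) (val H : set A) = [set: A]].
Proof.
apply/seteqP; split => Z /= hZ.
  by apply/seteqP; split => // a _; have [H ZH Ha] := hZ a; exists H.
by move=> a; have : [set: A] a by []; rewrite -hZ => -[H ZH Ha]; exists H.
Qed.

(* Main.v *)
Require Import Defs.
From mathcomp Require Import all_boot.
From mathcomp Require Import boolp classical_sets filter topology.

(** For a family [x] of points indexed by [B], and [a : A], let [T_a] be the
    set of the points [x H] with [a] in [H].  A point accumulates exactly when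
    it lies in the closure of every [T_a], as [accumulation_point_coveringE]
    shows; hence [x] has no accumulation point exactly when the open sets
    [O_a], the complements of the closures of the [T_a], cover [X].

    If [X] is [[B, A]]-compact, such a cover would have a subcover indexed by
    some [H] in [B]; but the point [x H] lies in [T_a] for every [a] in [H], so
    the subcover misses it.  Conversely, given an open cover [O] without a
    subcover indexed by a member of [B], choose for every [H] a point [x H]
    that the [O a] with [a] in [H] all miss.  Then [O a] is disjoint from
    [T_a], hence from its closure, and since the [O a] cover [X] no point
    accumulates. *)

Local Open Scope classical_set_scope.

(** The quantifier over neighbourhoods, which precedes the one over [A] in
    the definition of accumulation, commutes with it; for a fixed [a] what
    remains is adherence to one set. *)
Lemma accumulation_point_coveringE (X : topologicalType) (A : Type)
    (B : set (set A)) (x : set_type B -> X) (p : X) :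
  accumulation_point (covering_subfamilies B) x p <->
  forall a, closure (x @` [set H | (val H : set A) a]) p.
Proof.
split=> [acc a V | cl U [Uopen Up] a].
  rewrite nbhsE => -[U Up UV].
  have [H UxH Ha] := acc U Up a.
  by exists (x H); split; [exists H | exact: UV].
have [_ [[H Ha <-] UxH]] := cl a U (open_nbhs_nbhs (conj Uopen Up)).
by exists H.
Qed.

Lemma BA_compact_accumulation (X : topologicalType) (A : Type)
    (B : set (set A)) :
  BA_compact X B -> accumulation_property X (covering_subfamilies B).
Proof.
move=> Xcompact x; apply: contrapT => noacc.
pose T a := x @` [set H | (val H : set A) a].
have Oopen a : open (~` closure (T a)).
  by apply: closed_openC; exact: closed_closure.
have Ocover : \bigcup_a ~` closure (T a) = [set: X].
  apply/seteqP; split=> // p _; apply: contrapT => pNO; apply: noacc.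
  exists p; apply/accumulation_point_coveringE => a.
  by apply: contrapT => pNcl; apply: pNO; exists a.
have [H BH Hcover] := Xcompact _ Oopen Ocover.
pose i : set_type B := SigSub (mem_set BH).
have : [set: X] (x i) by [].
rewrite -Hcover => -[a Ha]; apply.
by apply: subset_closure; exists i.
Qed.

Lemma accumulation_BA_compact (X : topologicalType) (A : Type)
    (B : set (set A)) :
  accumulation_property X (covering_subfamilies B) -> BA_compact X B.
Proof.
move=> Xacc O Oopen Ocover; apply: contrapT => nosub.
have missed (H : set_type B) :
    exists y, ~ (\bigcup_(a in (val H : set A)) O a) y.
  apply: contrapT => all_hit; apply: nosub.
  exists (val H); first exact: set_valP.
  apply/seteqP; split=> // y _.
  by apply: contrapT => yNO; apply: all_hit; exists y.
have [x xP] := choice missed.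
have [p /accumulation_point_coveringE pcl] := Xacc x.
have : [set: X] p by [].
rewrite -Ocover => -[a _ Oap].
have [_ [[H Ha <-] OaxH]] := pcl a (O a) (open_nbhs_nbhs (conj (Oopen a) Oap)).
by apply: (xP H); exists a.
Qed.

Theorem corollary3p5 (X : topologicalType) (A : Type) (B : set (set A)) :
  BA_compact X B <-> accumulation_property X (covering_subfamilies B).
Proof.
split; [exact: BA_compact_accumulation | exact: accumulation_BA_compact].
Qed.
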